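(* Let $R$ be a one-dimensional commutative Noetherian local domain with maximal ideal $\mathfrak{m}$, and let $I$ be a nonzero, proper ideal of $R$. Assume that $I$ is weakly $\mathfrak{m}$-full. If $I\otimes_R I^{\ast}$ is torsion-free, then $I$ is principal and $R$ is a discrete valuation ring (DVR).
   Context: For an $R$-module $M$, $M^{\ast}=\mathrm{Hom}_R(M,R)$. An $R$-module $M$ is torsion-free if the natural map $M\to M\otimes_R Q$ is injective, where $Q$ is the total quotient ring of $R$. An ideal $I$ of a local ring $(R,\mathfrak{m})$ is weakly $\mathfrak{m}$-full if $(\mathfrak{m}I:_R\mathfrak{m})\subseteq I$, equivalently $(\mathfrak{m}I:_R\mathfrak{m})=I$, where $(A:_R B)=\{r\in R : rB\subseteq A\}$. *)

(* Defs.v *)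
From HB Require Import structures.
From mathcomp Require Import all_boot all_order all_algebra.
From mathcomp Require Import ring_quotient generic_quotient.
From mathcomp Require Import boolp classical_sets functions.
From mathcomp Require Export freeg.

Set Implicit Arguments.
Unset Strict Implicit.
Unset Printing Implicit Defensive.

Import GRing.Theory.
Local Open Scope classical_set_scope.
Local Open Scope ring_scope.
Local Open Scope quotient_scope.

(* Submodules of an R-module V are the library's [submodClosed V]; membership
   is boolean, which costs no generality in the presence of [asbool], `[< _ >].
   Ideals of R are the submodules of R^o. *)
Notation ideal R := (submodClosed R^o).

Section Span.
Context (R : comNzRingType) (V : lmodType R).

Definition submod_span (G : set V) : {pred V} :=
  [pred x | `[< smallest (fun S : set V => submod_closed (mem S)) G x >]].

Lemma submod_span_closed (G : set V) : submod_closed (submod_span G).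
Proof.
split; first by apply/asboolP => S [[S0 _] _]; rewrite inE in S0.
move=> a x y /asboolP Gx /asboolP Gy; apply/asboolP => S SG.
have := SG.1.2 a x y; rewrite !inE.
by apply; [apply: Gx | apply: Gy].
Qed.

HB.instance Definition _ (G : set V) :=
  GRing.isSubmodClosed.Build R V (submod_span G) (submod_span_closed G).

Lemma sub_submod_span (G : set V) x : G x -> x \in submod_span G.
Proof. by move=> Gx; apply/asboolP => S [_]; apply. Qed.

Lemma submod_span_min (G : set V) (S : submodClosed V) :
  (forall x, G x -> x \in S) -> {subset submod_span G <= S}.
Proof.
move=> GS x /asboolP/(_ [set` S]) /=; apply; split=> //.
by split=> [|a u v]; rewrite !inE /= ?rpred0 // => uS vS; rewrite rpredD ?rpredZ.
Qed.

End Span.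

Section SubModule.
Context (R : comNzRingType) (V : lmodType R) (S : submodClosed V).

Definition submod := {x : V | x \in S}.

HB.instance Definition _ := SubType.on submod.
HB.instance Definition _ := Choice.on submod.
HB.instance Definition _ := [SubChoice_isSubLmodule of submod by <:].

End SubModule.

Section QuotientModule.
Context (R : comNzRingType) (V : lmodType R) (S : submodClosed V).

(* [submodClosed] is a structure over semimodules and does not carry closure
   under opposite, which the library's quotient requires. *)
Definition submod_pred : {pred V} := [pred x | x \in S].

Fact submod_pred_zmod_closed : zmod_closed submod_pred.
Proof. exact: GRing.subsemimod_closedB (GRing.subsemimodClosedP S). Qed.

HB.instance Definition _ :=
  GRing.isZmodClosed.Build V submod_pred submod_pred_zmod_closed.

Definition quotmod := ring_quotient.Quotient.quot submod_pred.

HB.instance Definition _ := GRing.Zmodule.on quotmod.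
HB.instance Definition _ := Quotient.on quotmod.

Definition to_quotmod (x : V) : quotmod := \pi_(quotmod) x.

Definition quotmod_scale (a : R) (u : quotmod) : quotmod :=
  to_quotmod (a *: repr u).

Lemma to_quotmod_eq (x y : V) :
  to_quotmod x = to_quotmod y <-> x - y \in S.
Proof.
have -> : (x - y \in S) = (to_quotmod x == to_quotmod y).
  exact: (ring_quotient.Quotient.idealrBE submod_pred x y).
by split=> /eqP.
Qed.

Lemma to_quotmodD : {morph to_quotmod : x y / x + y}.
Proof. by move=> x y; rewrite /to_quotmod /= pi_addr. Qed.

Lemma to_quotmodZ a x : quotmod_scale a (to_quotmod x) = to_quotmod (a *: x).
Proof.
apply/to_quotmod_eq; rewrite -scalerBr rpredZ //; apply/to_quotmod_eq.
exact: reprK.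
Qed.

Fact quotmod_scaleA a b u :
  quotmod_scale a (quotmod_scale b u) = quotmod_scale (a * b) u.
Proof. by rewrite to_quotmodZ scalerA. Qed.

Fact quotmod_scale1 : left_id 1 quotmod_scale.
Proof. by move=> u; rewrite /quotmod_scale scale1r; apply: reprK. Qed.

Fact quotmod_scaleDr : right_distributive quotmod_scale +%R.
Proof.
move=> a u v; rewrite -[u]reprK -[v]reprK -/(to_quotmod _) -/(to_quotmod _).
by rewrite -to_quotmodD !to_quotmodZ scalerDr to_quotmodD.
Qed.

Fact quotmod_scaleDl u : {morph quotmod_scale^~ u : a b / a + b}.
Proof. by move=> a b; rewrite /quotmod_scale scalerDl to_quotmodD. Qed.

HB.instance Definition _ := GRing.Zmodule_isLmodule.Build R quotmod
  quotmod_scaleA quotmod_scale1 quotmod_scaleDr quotmod_scaleDl.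

End QuotientModule.

Section Hom.
Context (R : comNzRingType) (M N : lmodType R).

Definition is_linear : {pred M -> N} := [pred f | `[< linear f >]].

Lemma is_linear_submod_closed : submod_closed is_linear.
Proof.
split; first by apply/asboolP => a u v; rewrite [RHS]addr0 [RHS]scaler0.
move=> c f g /asboolP fL /asboolP gL; apply/asboolP => a u v.
change (c *: f (a *: u + v) + g (a *: u + v) =
        a *: (c *: f u + g u) + (c *: f v + g v)).
rewrite fL gL !scalerDr !scalerA (mulrC c) addrACA.
by congr (_ + _ + _).
Qed.

HB.instance Definition _ :=
  GRing.isSubmodClosed.Build R (M -> N) is_linear is_linear_submod_closed.

Definition hom_mod : lmodType R := submod is_linear.

End Hom.

Definition dual_mod (R : comNzRingType) (M : lmodType R) : lmodType R := hom_mod M R^o.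

Section Tensor.
Context (R : comNzRingType) (M N : lmodType R).

Local Notation free := {freeg (M * N)%type / R}.

(* << (x, y) >> is the basis vector of the free R-module on M * N indexed by
   (x, y). *)
Inductive bilinear_relation : set free :=
| BilinearDl x x' y :
    bilinear_relation (<< (x + x', y) >> - << (x, y) >> - << (x', y) >>)
| BilinearDr x y y' :
    bilinear_relation (<< (x, y + y') >> - << (x, y) >> - << (x, y') >>)
| BilinearZl a x y :
    bilinear_relation (<< (a *: x, y) >> - a *: << (x, y) >>)
| BilinearZr a x y :
    bilinear_relation (<< (x, a *: y) >> - a *: << (x, y) >>).

Definition tensor_mod : lmodType R := quotmod (submod_span bilinear_relation).

Definition pure_tensor (x : M) (y : N) : tensor_mod :=
  to_quotmod (submod_span bilinear_relation) << (x, y) >>.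

Lemma pure_tensorDl x x' y :
  pure_tensor (x + x') y = pure_tensor x y + pure_tensor x' y.
Proof.
rewrite -to_quotmodD; apply/to_quotmod_eq; rewrite opprD addrA.
apply: sub_submod_span; exact: BilinearDl.
Qed.

Lemma pure_tensorDr x y y' :
  pure_tensor x (y + y') = pure_tensor x y + pure_tensor x y'.
Proof.
rewrite -to_quotmodD; apply/to_quotmod_eq; rewrite opprD addrA.
apply: sub_submod_span; exact: BilinearDr.
Qed.

Lemma pure_tensorZl a x y : pure_tensor (a *: x) y = a *: pure_tensor x y.
Proof.
apply/esym; rewrite [LHS]to_quotmodZ; apply/esym/to_quotmod_eq.
apply: sub_submod_span; exact: BilinearZl.
Qed.

Lemma pure_tensorZr a x y : pure_tensor x (a *: y) = a *: pure_tensor x y.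
Proof.
apply/esym; rewrite [LHS]to_quotmodZ; apply/esym/to_quotmod_eq.
apply: sub_submod_span; exact: BilinearZr.
Qed.

Lemma tensor_modP (P : lmodType R) (f : M -> N -> P) :
    (forall y, linear (f^~ y)) -> (forall x, linear (f x)) ->
  exists g : {linear tensor_mod -> P}, forall x y, g (pure_tensor x y) = f x y.
Proof.
move=> fl fr; pose h := fglift (fun p : M * N => f p.1 p.2).
have hB u v : h (u - v) = h u - h v by apply: lift_is_additive.
have h1 x y : h << (x, y) >> = f x y by rewrite /h liftU scale1r.
have hD u v : h (u + v) = h u + h v.
  have := hB (u + v) v; rewrite addrK => ->; by rewrite subrK.
have h0 : h 0 = 0 by rewrite -(subrr 0) hB subrr.
have hZ a u : h (a *: u) = a *: h u.
  rewrite -[u in RHS]freeg_sumE -[a *: u]/(fgscale a u) /fgscale.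
  rewrite !(big_morph h hD h0) scaler_sumr.
  by apply: eq_bigr => p _; rewrite /h !liftU scalerA.
have fDl x x' y : f (x + x') y = f x y + f x' y.
  by have := fl y 1 x x'; rewrite !scale1r.
have fDr x y y' : f x (y + y') = f x y + f x y'.
  by have := fr x 1 y y'; rewrite !scale1r.
have fZl a x y : f (a *: x) y = a *: f x y.
  have f0 : f 0 y = 0 by apply: (addrI (f 0 y)); rewrite -fDl !addr0.
  by have := fl y a x 0; rewrite f0 !addr0.
have fZr a x y : f x (a *: y) = a *: f x y.
  have f0 : f x 0 = 0 by apply: (addrI (f x 0)); rewrite -fDr !addr0.
  by have := fr x a y 0; rewrite f0 !addr0.
pose ker : {pred free} := [pred u | h u == 0].
have ker_closed : submod_closed ker.
  split=> [|a u v]; rewrite !inE ?h0 //.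
  by move=> /eqP hu /eqP hv; rewrite hD hZ hu hv scaler0 addr0.
pose K := GRing.isSubmodClosed.Build R free ker ker_closed.
pose kerS : submodClosed free := HB.pack ker K.
have relK : {subset submod_span bilinear_relation <= kerS}.
  apply: submod_span_min => _ [] *; apply/eqP;
  by rewrite !(hB, hZ, h1) ?(fDl, fDr, fZl, fZr) ?subrr // addrAC addrK subrr.
pose g (t : tensor_mod) := h (repr t).
have gE u : g (to_quotmod _ u) = h u.
  apply/eqP; rewrite -subr_eq0 -hB; apply: relK; apply/to_quotmod_eq.
  exact: reprK.
have g_lin : linear g.
  have tE (t : tensor_mod) : t = to_quotmod _ (repr t) by rewrite -[LHS]reprK.
  move=> a t t'; rewrite (tE t) (tE t') [a *: to_quotmod _ _]to_quotmodZ.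
  by rewrite -to_quotmodD !gE hD hZ.
pose G := GRing.isLinear.Build R tensor_mod P _ g g_lin.
pose gL : {linear tensor_mod -> P} := HB.pack g G.
by exists gL => x y; rewrite /= gE h1.
Qed.

End Tensor.

(* {fraction R} as an R-module; R is a domain, so this is its total quotient
   ring. *)
Section FractionModule.
Context (R : idomainType).

Definition fracmod := {fraction R}.

HB.instance Definition _ := GRing.Zmodule.on fracmod.

Definition fracmod_scale (a : R) (q : fracmod) : fracmod :=
  FracField.tofrac a * (q : {fraction R}).

Fact fracmod_scaleA a b q :
  fracmod_scale a (fracmod_scale b q) = fracmod_scale (a * b) q.
Proof. by rewrite /fracmod_scale tofracM mulrA. Qed.

Fact fracmod_scale1 : left_id 1 fracmod_scale.
Proof. by move=> q; rewrite /fracmod_scale tofrac1 mul1r. Qed.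

Fact fracmod_scaleDr : right_distributive fracmod_scale +%R.
Proof. by move=> a p q; rewrite /fracmod_scale mulrDr. Qed.

Fact fracmod_scaleDl q : {morph fracmod_scale^~ q : a b / a + b}.
Proof. by move=> a b; rewrite /fracmod_scale tofracD mulrDl. Qed.

HB.instance Definition _ := GRing.Zmodule_isLmodule.Build R fracmod
  fracmod_scaleA fracmod_scale1 fracmod_scaleDr fracmod_scaleDl.

End FractionModule.

Definition torsion_free (R : idomainType) (M : lmodType R) : Prop :=
  injective (fun x : M => pure_tensor x ((1 : {fraction R}) : fracmod R)).

Section Ideals.
Context (R : comNzRingType).
Implicit Types I J P m : ideal R.

Definition is_proper I : Prop := exists x : R, x \notin I.

Definition nonzero_ideal I : Prop := exists2 x : R, x \in I & x != 0.

Definition principal_ideal I : Prop :=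
  exists a : R, I =i submod_span [set (a : R^o)].

Definition finitely_generated I : Prop :=
  exists s : seq R^o, I =i submod_span [set` s].

Definition noetherian : Prop := forall I, finitely_generated I.

Definition prime_ideal P : Prop :=
  is_proper P /\ prime_idealr_closed (P : {pred R}).

Definition maximal_ideal m : Prop :=
  is_proper m /\ forall J, is_proper J -> {subset m <= J} -> {subset J <= m}.

(* R is local with maximal ideal m. *)
Definition local_ring m : Prop :=
  maximal_ideal m /\ forall n : ideal R, maximal_ideal n -> n =i m.

(* P 0, ..., P n is a strictly increasing chain of prime ideals; the values
   of P beyond n are irrelevant. *)
Definition prime_chain (n : nat) (P : nat -> ideal R) : Prop :=
  (forall i, (i <= n)%N -> prime_ideal (P i)) /\
  (forall i, (i < n)%N ->
    {subset P i <= P i.+1} /\ ~ {subset P i.+1 <= P i}).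

Definition krull_dim (d : nat) : Prop :=
  (exists P : nat -> ideal R, prime_chain d P) /\
  (forall n (P : nat -> ideal R), prime_chain n P -> (n <= d)%N).

Definition idealM I J : {pred R^o} :=
  submod_span [set z : R^o | exists x y : R, [/\ x \in I, y \in J & z = x * y]].

Definition colon (A B : {pred R^o}) : {pred R^o} :=
  [pred r : R | `[< forall b : R, b \in B -> r * b \in A >]].

Definition weakly_full m I : Prop := {subset colon (idealM m I) m <= I}.

End Ideals.

Arguments noetherian : clear implicits.
Arguments krull_dim : clear implicits.

(* A principal ideal domain with exactly one nonzero maximal ideal. *)
Definition dvr (R : idomainType) : Prop :=
  (forall I : ideal R, principal_ideal I) /\
  exists m : ideal R, [/\ maximal_ideal m, nonzero_ideal m &
    forall n : ideal R, maximal_ideal n -> nonzero_ideal n -> n =i m].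

(* Main.v *)
Require Import Defs.
From mathcomp Require Import all_boot all_order all_algebra.
From HB Require Import structures.
From mathcomp Require Import boolp classical_sets.

(* Put N = Hom(I, R). Torsion-freeness makes evaluation I (x) N -> R injective.
   Weak m-fullness makes I stable under m : m, so if R is not a DVR then
   End(I) is strictly larger than R; it remains to refute this.
   Let b_0, ..., b_n be minimal generators of N (one generator would force
   End(I) = R) and W the ideal of 0-th coefficients of the relations between
   them, so that 0 <> W <= m and the 0-th coordinate is well defined from
   I (x) N to I / W I. As e a (x) b_0 = a (x) (b_0 o e), each e in End(I) acts
   on I / W I as a scalar; likewise End(I) <> N, since otherwise all b_j would
   map I into m I.
   Choose f in N outside End(I) with m f inside End(I), then x with f x a socle
   element modulo I, and by weak m-fullness z in m with z f x outside m I. Then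
   e = z f is in End(I) and its scalar is a unit. A relation (w_j) gives
   w_j f a in I, whence f(a) w_0 in W I by injectivity. Thus
   W I = e(W I) <= z W I modulo m W I, so W I = 0 by Nakayama, a contradiction. *)

Set Implicit Arguments.
Unset Strict Implicit.
Unset Printing Implicit Defensive.

Import GRing.Theory.
Local Open Scope ring_scope.

(** * Ideals given by membership conditions, and the maximal condition in Noetherian rings *)

Section Submodules.
Context (R : comNzRingType).

Lemma submodule_of (V : lmodType R) (P : V -> Prop) :
    P 0 -> (forall a u v, P u -> P v -> P (a *: u + v)) ->
  exists S : submodClosed V, forall x, x \in S <-> P x.
Proof.
move=> P0 PD; pose p : {pred V} := [pred x | `[< P x >]].
have pcl : submod_closed p.
  split=> [|a u v]; first exact/asboolP.
  by move=> /asboolP Pu /asboolP Pv; apply/asboolP; apply: PD.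
pose mx := GRing.isSubmodClosed.Build R V p pcl.
pose S : submodClosed V := HB.pack p mx.
by exists S => x; split=> /asboolP.
Qed.

Lemma ideal_mulr (A : ideal R) (r x : R) : x \in A -> r * x \in A.
Proof. by move=> Ax; exact: (@rpredZ R R^o A r x Ax). Qed.

Lemma idealM_mem (I J : ideal R) (x y : R) :
  x \in I -> y \in J -> x * y \in idealM I J.
Proof. by move=> Ix Jy; apply: sub_submod_span; exists x, y. Qed.

Lemma idealM_ideal (I J : ideal R) : exists S : ideal R, S =i idealM I J.
Proof.
have [S0 SD] := submod_span_closed
  [set z : R^o | exists x y : R, [/\ x \in I, y \in J & z = x * y]]%classic.
have [S SP] : exists S : ideal R, forall x, x \in S <-> x \in idealM I J.
  by apply: submodule_of => // a u v Su Sv; apply: SD.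
by exists S => x; apply/idP/idP => /SP.
Qed.

Lemma principal_of (a : R) :
  exists A : ideal R, forall x, x \in A <-> exists r, x = r * a.
Proof.
apply: submodule_of; first by exists 0; rewrite mul0r.
by move=> c _ _ [r ->] [s ->]; exists (c * r + s); rewrite mulrDl -mulrA.
Qed.

Lemma submod_span1P (a x : R) :
  x \in submod_span [set (a : R^o)]%classic <-> exists r, x = r * a.
Proof.
have [S SP] := principal_of a.
split=> [|[r ->]]; last by apply: ideal_mulr; apply: sub_submod_span.
move=> xS; apply/SP; apply: submod_span_min xS => _ ->.
by apply/SP; exists 1; rewrite mul1r.
Qed.

Context (Rnoeth : noetherian R).

(** Otherwise choice builds a strictly increasing chain in [F]; its union [U] is finitely generated,
    so one member of the chain already equals [U]. *)
Lemma noetherian_maximal (F : ideal R -> Prop) (A0 : ideal R) : F A0 ->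
  exists2 A : ideal R, F A & forall B : ideal R, F B -> {subset A <= B} -> {subset B <= A}.
Proof.
move=> FA0; apply: contrapT => noMax.
pose T := {A : ideal R | F A}.
have step (A : T) : exists B : T,
    {subset sval A <= sval B} /\ ~ {subset sval B <= sval A}.
  apply: contrapT => nB; apply: noMax; exists (sval A); first exact: svalP.
  move=> B FB AB; apply: contrapT => nBA; apply: nB.
  by exists (exist _ B FB).
have [f fP] := choice step.
pose C n := sval (iter n f (exist _ A0 FA0)).
have C_mono k n : (k <= n)%N -> {subset C k <= C n}.
  move=> /subnK <-; elim: (n - k)%N => // j IHj x /IHj.
  exact: (fP _).1.
have [U UP] : exists U : ideal R, forall x, x \in U <-> exists n, x \in C n.
  apply: submodule_of; first by exists 0; apply: rpred0.
  move=> a u v [k Cu] [n Cv]; exists (maxn k n).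
  apply: rpredD; first apply: rpredZ.
    by apply: C_mono Cu; apply: leq_maxl.
  by apply: C_mono Cv; apply: leq_maxr.
have [s Us] := Rnoeth U.
have [n sC] : exists n, forall x, x \in s -> x \in C n.
  have : forall x, x \in s -> x \in U.
    by move=> x xs; rewrite Us; apply: sub_submod_span.
  elim: s {Us} => [|y s IHs] sU; first by exists 0%N.
  have [k Ck] := IHs (fun x xs => sU x (mem_behead (s := y :: s) xs)).
  have /UP [n Cy] := sU y (mem_head y s).
  exists (maxn k n) => x; rewrite inE => /orP [/eqP ->|xs].
    by apply: C_mono Cy; apply: leq_maxr.
  by apply: C_mono (Ck x xs); apply: leq_maxl.
apply: (fP (iter n f (exist _ A0 FA0))).2 => x Cx.
have : x \in U by apply/UP; exists n.+1.
by rewrite Us; apply: submod_span_min => y; apply: sC.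
Qed.

End Submodules.

(** * Local Noetherian domains: units, Nakayama, a DVR criterion, socle elements *)

Section LocalRing.
Context (R : idomainType) (m : ideal R).
Context (Rnoeth : noetherian R) (Rlocal : local_ring m).

Lemma one_notin_maximal : (1 : R) \notin m.
Proof.
have [[[x mx] _] _] := Rlocal; apply: contra mx => m1.
by rewrite -[x]mulr1; apply: ideal_mulr.
Qed.

(** An ideal maximal among the proper ones containing [A] is a maximal ideal, hence [m] by
    locality. *)
Lemma proper_sub_maximal (A : ideal R) : is_proper A -> {subset A <= m}.
Proof.
move=> Apr.
have [M [Mpr AM] Mmax] := noetherian_maximal Rnoeth
  (F := fun B => is_proper B /\ {subset A <= B}) (conj Apr (fun x => id)).
have Mm : M =i m.
  apply: Rlocal.2; split=> // J Jpr MJ; apply: Mmax => //; split=> //.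
  by move=> x /AM /MJ.
by move=> x /AM; rewrite Mm.
Qed.

Lemma notin_maximal_unit (r : R) : r \notin m -> exists s, s * r = 1.
Proof.
move=> mr; apply: contrapT => nU.
have [A AP] := principal_of r.
have : r \in m; last by apply/negP.
apply: (@proper_sub_maximal A); last by apply/AP; exists 1; rewrite mul1r.
by exists 1; apply/negP => /AP [s s1]; apply: nU; exists s.
Qed.

Lemma maximal_prime : prime_ideal m.
Proof.
split=> [|u v uv]; first by exists 1; apply: one_notin_maximal.
have [//|/notin_maximal_unit [s su]] := boolP (u \in m).
by rewrite -[v]mul1r -su -mulrA; apply: ideal_mulr.
Qed.

(** In a generating family of least size, a relation with a coefficient outside [m], hence a unit,
    would eliminate a generator. *)
Lemma minimal_generators (A : ideal R) :
  exists n (d : 'I_n -> R),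
    (forall x, x \in A <-> exists r : 'I_n -> R, x = \sum_j r j * d j) /\
    forall r : 'I_n -> R, \sum_j r j * d j = 0 -> forall j, r j \in m.
Proof.
pose gen n := exists d : 'I_n -> R,
  forall x, x \in A <-> exists r : 'I_n -> R, x = \sum_j r j * d j.
have exgen : exists n, `[< gen n >].
  have [s As] := Rnoeth A.
  exists (size s); apply/asboolP; exists (fun j => s`_j) => x; rewrite As.
  have [S SP] : exists S : ideal R, forall x, x \in S <->
      exists r : 'I_(size s) -> R, x = \sum_j r j * s`_j.
    apply: submodule_of.
      by exists (fun=> 0); rewrite big1 // => j _; rewrite mul0r.
    move=> a _ _ [r ->] [t ->]; exists (fun j => a * r j + t j).
    rewrite [a *: _]mulr_sumr -big_split; apply: eq_bigr => j _ /=.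
    by rewrite mulrDl mulrA.
  rewrite -SP; split.
    apply: submod_span_min => y ys; apply/SP.
    have lt : (index y s < size s)%N by rewrite index_mem.
    exists (fun j => (j == Ordinal lt)%:R).
    rewrite (bigD1 (Ordinal lt)) //= eqxx mul1r nth_index // big1 ?addr0 //.
    by move=> j /negPf ->; rewrite mul0r.
  move=> /SP [r ->]; apply: rpred_sum => j _; apply: ideal_mulr.
  by apply: sub_submod_span; apply: mem_nth.
case: (ex_minnP exgen) => n /asboolP [d dP] nmin; exists n, d; split=> // r r0 j.
have [//|/notin_maximal_unit [u ur]] := boolP (r j \in m).
case: n d dP nmin r r0 j ur => [|n] d dP nmin r r0 j ur; first by case: j {ur}.
suff /nmin : `[< gen n >] by rewrite ltnn.
(* The relation solved for [d j], where [u] is the inverse of [r j]. *)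
have dj : d j = - (u * \sum_(i < n) r (lift j i) * d (lift j i)).
  move: r0; rewrite (bigD1_ord j) //= => /eqP; rewrite addr_eq0 => /eqP r0.
  by rewrite -mulrN -[X in u * X]opprK opprK -r0 mulrA ur mul1r.
apply/asboolP; exists (fun i => d (lift j i)) => x; rewrite dP.
split=> [[t ->]|[t ->]].
  exists (fun i => t (lift j i) - t j * u * r (lift j i)).
  rewrite (bigD1_ord j) //= dj mulrN mulr_sumr mulr_sumr -sumrN -big_split /=.
  by apply: eq_bigr => i _; rewrite mulrBl addrC !mulrA.
exists (fun i => if unlift j i is Some k then t k else 0).
rewrite (bigD1_ord j) //= unlift_none mul0r add0r.
by apply: eq_bigr => i _; rewrite liftK.
Qed.

(** For a nonempty minimal family, [d ord0] in [m A] gives a relation with coefficient [1 - r ord0]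
    at [ord0], where [r ord0] is in [m]; minimality then puts [1] in [m]. *)
Lemma nakayama (A : ideal R) (x : R) :
  {subset A <= idealM m A} -> x \in A -> x = 0.
Proof.
move=> AmA; have [n [d [dP dmin]]] := minimal_generators A.
case: n d dP dmin => [|n] d dP dmin Ax.
  by have /dP [r ->] := Ax; rewrite big_ord0.
have [S SP] : exists S : ideal R, forall x, x \in S <->
    exists2 r : 'I_n.+1 -> R, (forall j, r j \in m) & x = \sum_j r j * d j.
  apply: submodule_of.
    exists (fun=> 0) => [j|]; first exact: rpred0.
    by rewrite big1 // => j _; rewrite mul0r.
  move=> a _ _ [r rm ->] [t tm ->]; exists (fun j => a * r j + t j).
    by move=> j; apply: rpredD => //; apply: ideal_mulr.
  rewrite [a *: _]mulr_sumr -big_split; apply: eq_bigr => j _ /=.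
  by rewrite mulrDl mulrA.
have /AmA : d ord0 \in A.
  apply/dP; exists (fun j => (j == ord0)%:R).
  rewrite (bigD1 ord0) //= mul1r big1 ?addr0 // => j /negPf ->.
  by rewrite mul0r.
have mAS : {subset idealM m A <= S}.
  apply: submod_span_min => _ [a [y [am /dP [r ->] ->]]].
  apply/SP; exists (fun j => a * r j) => [j|].
    by rewrite mulrC; apply: ideal_mulr.
  by rewrite mulr_sumr; apply: eq_bigr => j _; rewrite mulrA.
move=> /mAS /SP [r rm d0].
have m1 : (ord0 == ord0 :> 'I_n.+1)%:R - r ord0 \in m.
  apply: (dmin (fun j => (j == ord0)%:R - r j)).
  under eq_bigr do rewrite mulrBl.
  rewrite sumrB -d0 (bigD1 ord0) //= mul1r big1 ?addr0 ?subrr //.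
  by move=> j /negPf ->; rewrite mul0r.
have : 1 - r ord0 + r ord0 \in m by apply: rpredD.
by rewrite subrK => m1'; move: one_notin_maximal; rewrite m1'.
Qed.

(* A maximal non-principal ideal [A] lies in [m = R w]; then [A = w B] with
   [A <= B], so [B] is principal or [A = m A = 0]. *)
Lemma principal_maximal_dvr (w : R) :
  nonzero_ideal m -> w \in m -> (forall x, x \in m -> exists r, x = r * w) -> dvr R.
Proof.
move=> mnz wm mw; split; last first.
  by exists m; split=> [||n nmax _]; [apply: Rlocal.1| |apply: Rlocal.2].
have principalP (A : ideal R) a :
    (forall x, x \in A <-> exists r, x = r * a) -> principal_ideal A.
  move=> Aa; exists a => x; apply/idP/idP; first by move=> /Aa /submod_span1P.
  by move=> /submod_span1P /Aa.
move=> A0; apply: contrapT => A0np.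
have [A Anp Amax] := noetherian_maximal Rnoeth (F := fun A => ~ principal_ideal A) A0np.
have Apr : is_proper A.
  apply: contrapT => nA; apply: Anp; apply: (principalP _ 1) => x.
  split=> [_|_]; first by exists x; rewrite mulr1.
  by apply: contrapT => /negP Ax; apply: nA; exists x.
have Am x : x \in A -> exists r, x = r * w.
  by move=> /(proper_sub_maximal Apr); apply: mw.
have [B BP] : exists B : ideal R, forall x, x \in B <-> x * w \in A.
  apply: submodule_of; first by rewrite mul0r; apply: rpred0.
  move=> a u v Au Av; rewrite mulrDl; apply: rpredD => //.
  by rewrite -mulrA; apply: ideal_mulr.
have [[c Bc]|Bnp] := pselect (principal_ideal B).
  apply: Anp; apply: (principalP _ (c * w)) => x; split=> [Ax|[r ->]].
    have [r xE] := Am x Ax.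
    have /submod_span1P [s rE] : r \in submod_span [set (c : R^o)]%classic.
      by rewrite -Bc; apply/BP; rewrite -xE.
    by exists s; rewrite mulrA -rE.
  apply: ideal_mulr; apply/BP; rewrite Bc; apply/submod_span1P; exists 1.
  by rewrite mul1r.
have BA : {subset B <= A}.
  by apply: Amax => // x Ax; apply/BP; rewrite mulrC; apply: ideal_mulr.
apply: Anp; apply: (principalP _ 0) => x; split=> [Ax|[r ->]]; last first.
  by rewrite mulr0; apply: rpred0.
exists 0; rewrite mulr0; apply: nakayama Ax => y Ay.
have [r yE] := Am y Ay.
rewrite yE mulrC; apply: idealM_mem => //; apply: BA; apply/BP.
by rewrite -yE.
Qed.

Context (Rdim : krull_dim R 1).

(** Otherwise [P] lies strictly between [0] and [m], giving a prime chain of length two. *)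
Lemma nonzero_prime_maximal (P : ideal R) :
  prime_ideal P -> nonzero_ideal P -> {subset m <= P}.
Proof.
move=> Ppr [c Pc c0]; apply: contrapT => mP.
have [Z ZP] : exists Z : ideal R, forall x, x \in Z <-> x = 0.
  by apply: submodule_of => // a _ _ -> ->; rewrite scaler0 addr0.
have Zpr : prime_ideal Z.
  split=> [|u v /ZP /eqP]; first by exists c; apply/negP => /ZP /eqP; apply/negP.
  by rewrite mulf_eq0 => /orP [] /eqP ->; apply/orP; [left|right]; apply: rpred0.
have Pm := proper_sub_maximal Ppr.1.
suff /Rdim.2 : prime_chain 2 (fun i => nth m [:: Z; P; m] i) by [].
split.
  by case=> [|[|[|]]] //= _; exact: maximal_prime.
case=> [|[|]] //= _; split=> //.
  by move=> x /ZP ->; apply: rpred0.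
by move=> /(_ c Pc) /ZP /eqP; apply/negP.
Qed.

(* A maximal ideal among the proper [A : r y] is prime, and nonzero as it
   contains [c], hence equal to [m]. *)
Lemma socle_element (V : lmodType R) (A : submodClosed V) (y : V) (c : R) :
    y \notin A -> c != 0 -> c *: y \in A ->
  exists2 r, r *: y \notin A & forall w, w \in m -> w *: (r *: y) \in A.
Proof.
move=> Ay c0 Acy.
have colonP (z : V) : exists J : ideal R, forall s, s \in J <-> s *: z \in A.
  apply: submodule_of; first by rewrite scale0r rpred0.
  move=> a u v Au Av; rewrite scalerDl; apply: rpredD => //.
  by rewrite -[_ *: z]scalerA; apply: rpredZ.
pose F (J : ideal R) := exists r, r *: y \notin A /\ forall s, s \in J <-> s *: (r *: y) \in A.
have scalerC (a b : R) (z : V) : a *: (b *: z) = b *: (a *: z).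
  by rewrite !scalerA mulrC.
have [J0 J0P] := colonP y.
have J0F : F J0 by exists 1; rewrite !scale1r.
have [P [r [Ary PP]] Pmax] := noetherian_maximal Rnoeth J0F.
exists r => // w mw; apply/PP; apply: nonzero_prime_maximal mw.
  split=> [|s t st]; first by exists 1; apply/negP => /PP; rewrite scale1r; apply/negP.
  have [|Pt] := boolP (t \in P); first by rewrite orbT.
  rewrite orbF; have trE : (t * r) *: y = t *: (r *: y) by rewrite scalerA.
  have Aty : (t * r) *: y \notin A by rewrite trE; apply: contra Pt => /PP.
  (* Passing from [r] to [t * r] only enlarges the colon ideal, so [J] is again [P] by maximality,
     and [s * t] in [P] puts [s] in [J]. *)
  have [J JP] := colonP ((t * r) *: y).
  apply: (Pmax J); first by exists (t * r).
    by move=> u /PP Pu; apply/JP; rewrite trE scalerC; apply: rpredZ.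
  by apply/JP; rewrite trE scalerA; apply/PP.
by exists c => //; apply/PP; rewrite scalerC; apply: rpredZ.
Qed.

End LocalRing.

(** * The dual of an ideal, and coordinates on its tensor product with the ideal *)

Section Dual.
Context (R : idomainType) (I : ideal R).

Local Notation N := (dual_mod (submod I)).
Implicit Types (f g : N) (a : submod I).

Definition app f a : R := (\val f : submod I -> R^o) a.

Lemma app_linear f : linear (app f : submod I -> R^o).
Proof. exact: (asboolW (valP f)). Qed.

Lemma appD f a a' : app f (a + a') = app f a + app f a'.
Proof. by have := app_linear f 1 a a'; rewrite !scale1r. Qed.

Lemma app0 f : app f 0 = 0.
Proof. by apply: (addrI (app f 0)); rewrite -appD !addr0. Qed.

Lemma appZ f r a : app f (r *: a) = r * app f a.
Proof. by have := app_linear f r a 0; rewrite !addr0 app0 addr0. Qed.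

Lemma app_addl f g a : app (f + g) a = app f a + app g a.
Proof. by []. Qed.

Lemma app_scalel r f a : app (r *: f) a = r * app f a.
Proof. by []. Qed.

Lemma app_zerol a : app (0 : N) a = 0.
Proof. by []. Qed.

Lemma app_combination n (c : 'I_n -> R) (b : 'I_n -> N) a :
  app (\sum_j c j *: b j) a = \sum_j c j * app (b j) a.
Proof. by rewrite (big_morph (app^~ a) (fun f g => app_addl f g a) (app_zerol a)). Qed.

Lemma app_inj f g : app f =1 app g -> f = g.
Proof. by move=> fg; apply: val_inj; apply: functional_extensionality_dep. Qed.

Lemma dual_of (h : submod I -> R) :
  linear (h : submod I -> R^o) -> exists f, app f =1 h.
Proof.
move=> hL; have hP : (h : submod I -> R^o) \in @is_linear R (submod I) R^o by apply/asboolP.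
by exists (exist (fun h => h \in @is_linear R (submod I) R^o) _ hP).
Qed.

(** By linearity both sides are [f] applied to the product of [a] and [a']. *)
Lemma app_exchange f a a' : app f a * \val a' = app f a' * \val a.
Proof.
rewrite mulrC [RHS]mulrC -!appZ; congr app; apply: val_inj.
by rewrite !linearZ /= [LHS]mulrC.
Qed.

(** A consequence of [app_exchange] in a domain: evaluation at a nonzero element embeds the dual
    into [R]. *)
Lemma app_eq0 f a : a != 0 -> app f a = 0 -> f = 0.
Proof.
move=> a0 fa0; apply: app_inj => a'; apply: (mulIf (x := \val a)).
  by apply: contra a0 => /eqP va0; apply/eqP; apply: val_inj; rewrite va0.
by rewrite -app_exchange fa0 app_zerol !mul0r.
Qed.

(** [h] is [f] composed with [g]; quantifying over [a'] keeps the membership proof of [app g a] out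
    of the statement. *)
Lemma dual_comp f g : (forall a, app g a \in I) ->
  exists h, forall a a', \val a' = app g a -> app h a = app f a'.
Proof.
move=> gI; pose e a : submod I := exist (fun x : R^o => x \in I) _ (gI a).
have [|h hE] := @dual_of (fun a => app f (e a)).
  move=> r a a'; have -> : e (r *: a + a') = r *: e a + e a'.
    by apply: val_inj; exact: (app_linear g).
  exact: app_linear.
by exists h => a a' a'E; rewrite hE; congr app; apply: val_inj.
Qed.

(** Evaluation at [a0] identifies the dual with an ideal of [R], whose minimal generators are pulled
    back. *)
Lemma dual_minimal_generators (m : ideal R) (a0 : submod I) :
    noetherian R -> local_ring m -> a0 != 0 ->
  exists n (b : 'I_n -> N),
    (forall f, exists r : 'I_n -> R, f = \sum_j r j *: b j) /\
    forall r : 'I_n -> R, \sum_j r j *: b j = 0 -> forall j, r j \in m.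
Proof.
move=> Rnoeth Rlocal a00.
have [A AP] : exists A : ideal R, forall x, x \in A <-> exists f, x = app f a0.
  apply: submodule_of; first by exists 0.
  by move=> r _ _ [f ->] [g ->]; exists (r *: f + g); rewrite app_addl app_scalel.
have [n [d [dP dmin]]] := minimal_generators Rnoeth Rlocal A.
have /choice [b bE] j : exists f, app f a0 = d j.
  suff /AP [f ->] : d j \in A by exists f.
  apply/dP; exists (fun i => (i == j)%:R).
  by rewrite (bigD1 j) //= eqxx mul1r big1 ?addr0 // => i /negPf ->; rewrite mul0r.
have comb (r : 'I_n -> R) : app (\sum_j r j *: b j) a0 = \sum_j r j * d j.
  by rewrite app_combination; apply: eq_bigr => j _; rewrite bE.
exists n, b; split=> [f|r r0].
  have /dP [r rE] : app f a0 \in A by apply/AP; exists f.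
  exists r; apply/eqP; rewrite -subr_eq0; apply/eqP; apply: (app_eq0 a00).
  rewrite app_addl -scaleN1r app_scalel comb rE mulN1r subrr //.
by apply: dmin; rewrite -comb r0.
Qed.

Context (Itf : torsion_free (tensor_mod (submod I) N)) (a0 : submod I) (a00 : a0 != 0).

(** The tensor is killed by [a0], which becomes invertible in the fraction field, so
    torsion-freeness makes it zero. *)
Lemma evaluation_kernel k (x : 'I_k -> submod I) (f : 'I_k -> N) :
  \sum_l app (f l) (x l) = 0 -> \sum_l pure_tensor (x l) (f l) = 0.
Proof.
move=> fx0; set T := \sum_l _.
have aT : \val a0 *: T = 0.
  rewrite scaler_sumr.
  (* [a0 *: (x (x) f) = a0 (x) x *: f], and [\sum_l x_l *: f_l] is the zero
     functional, since its value at [y] is [y * \sum_l f_l x_l]. *)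
  have -> : \sum_l \val a0 *: pure_tensor (x l) (f l) =
            pure_tensor a0 (\sum_l \val (x l) *: f l).
    rewrite (big_morph (pure_tensor a0) (pure_tensorDr a0) (id1 := 0)); last first.
      by rewrite -[X in pure_tensor _ X](scale0r 0) pure_tensorZr scale0r.
    apply: eq_bigr => l _; rewrite pure_tensorZr -!pure_tensorZl.
    by congr pure_tensor; apply: val_inj; rewrite !linearZ /= [LHS]mulrC.
  suff -> : \sum_l \val (x l) *: f l = 0.
    by rewrite -[X in pure_tensor _ X](scale0r 0) pure_tensorZr scale0r.
  apply: app_inj => y; rewrite app_combination app_zerol.
  under eq_bigr do rewrite mulrC app_exchange.
  by rewrite -mulr_suml fx0 mul0r.
apply: Itf => /=.
have va0 : FracField.tofrac (\val a0 : R) != 0 :> {fraction R}.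
  rewrite tofrac_eq0; apply: contra a00 => /eqP va0; apply/eqP.
  by apply: val_inj; rewrite va0.
pose q : fracmod R := (FracField.tofrac (\val a0 : R))^-1 : {fraction R}.
(* With [q] the inverse of [a0], [T (x) 1] becomes [a0 T (x) q], and [a0 T] is zero. *)
have -> : ((1 : {fraction R}) : fracmod R) = (\val a0 : R) *: q.
  by rewrite [RHS]mulfV.
rewrite !pure_tensorZr -!pure_tensorZl aT; congr pure_tensor.
by rewrite scaler0.
Qed.

Context (n : nat) (b : 'I_n -> N).
Context (bgen : forall f, exists r : 'I_n -> R, f = \sum_j r j *: b j).

(** The [i]-th coordinate of a functional is defined only up to relations, and [S] absorbs this
    ambiguity. Sending [a (x) f] to that coordinate times [a] is thus a linear map to [R / S], which
    is applied to a tensor that vanishes by [evaluation_kernel]. *)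
Lemma coordinate_kernel (i : 'I_n) (S : ideal R) :
    (forall r : 'I_n -> R, \sum_j r j *: b j = 0 ->
       forall a : submod I, r i * \val a \in S) ->
  forall k (x : 'I_k -> submod I) (c : 'I_k -> 'I_n -> R),
    \sum_l app (\sum_j c l j *: b j) (x l) = 0 ->
    \sum_l c l i * \val (x l) \in S.
Proof.
move=> SW k x c cx0.
(* [co f] is an arbitrary choice of coordinates; [rel] shows that modulo [S] the choice does not
   matter. *)
have /choice [co coE] := bgen.
have rel (r s : 'I_n -> R) a : \sum_j r j *: b j = \sum_j s j *: b j ->
    r i * \val a - s i * \val a \in S.
  move=> rs; rewrite -mulrBl; apply: (SW (fun j => r j - s j)).
  by under eq_bigr do rewrite scalerBl; rewrite sumrB rs subrr.
pose beta (a : submod I) (f : N) : quotmod S := to_quotmod S (co f i * \val a).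
have betaE r a : beta a (\sum_j r j *: b j) = to_quotmod S (r i * \val a).
  by apply/to_quotmod_eq; apply: rel; rewrite -coE.
have beta_l f : linear (beta^~ f).
  move=> r a a'; rewrite /beta [r *: to_quotmod _ _]to_quotmodZ -to_quotmodD.
  congr to_quotmod; rewrite linearD linearZ /= mulrDr; congr (_ + _).
  exact: mulrCA.
have beta_r a : linear (beta a).
  move=> r f g; rewrite [r *: to_quotmod _ _]to_quotmodZ -to_quotmodD.
  rewrite [in LHS](coE f) [in LHS](coE g) scaler_sumr -big_split /=.
  under eq_bigr do rewrite scalerA -scalerDl.
  by rewrite betaE mulrDl -mulrA.
have [h hE] := tensor_modP beta_l beta_r.
have : \sum_l beta (x l) (\sum_j c l j *: b j) = 0.
  by under eq_bigr do rewrite -hE; rewrite -linear_sum evaluation_kernel ?linear0.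
under eq_bigr do rewrite betaE.
have tq0 : to_quotmod S 0 = 0.
  by rewrite -[RHS](scale0r (to_quotmod S 0)) [RHS]to_quotmodZ scale0r.
rewrite -(big_morph _ (@to_quotmodD _ _ S) tq0) -tq0 => /to_quotmod_eq.
by rewrite subr0.
Qed.

(** The two-term case of [coordinate_kernel], with the second functional negated. *)
Lemma coordinate_eq (i : 'I_n) (S : ideal R) (x y : submod I) (c d : 'I_n -> R) :
    (forall r : 'I_n -> R, \sum_j r j *: b j = 0 ->
       forall a : submod I, r i * \val a \in S) ->
    app (\sum_j c j *: b j) x = app (\sum_j d j *: b j) y ->
  c i * \val x - d i * \val y \in S.
Proof.
move=> SW cxdy; have := coordinate_kernel SW (k := 2)
  (x := tnth [tuple x; y]) (c := tnth [tuple c; (fun j => - d j)]).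
rewrite !big_ord_recl !big_ord0 !addr0 !(tnth_nth x) !(tnth_nth c) /= mulNr; apply.
have -> : \sum_j - d j *: b j = - \sum_j d j *: b j.
  by rewrite -sumrN; apply: eq_bigr => j _; rewrite scaleNr.
by rewrite -scaleN1r app_scalel mulN1r cxdy subrr.
Qed.

Lemma delta_combination (i : 'I_n) : \sum_j (j == i)%:R *: b j = b i.
Proof.
rewrite (bigD1 i) //= eqxx scale1r big1 ?addr0 // => j /negPf ->.
by rewrite scale0r.
Qed.

(** The tensors [e a (x) b i] and [a (x) (b i o e)] have the same evaluation; the scalar is the
    [i]-th coordinate of [b i o e]. *)
Lemma stable_functional_scalar (i : 'I_n) (S : ideal R) (e : N) :
    (forall r : 'I_n -> R, \sum_j r j *: b j = 0 ->
       forall a : submod I, r i * \val a \in S) ->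
    (forall a, app e a \in I) ->
  exists r : R, forall a, app e a - r * \val a \in S.
Proof.
move=> SW eI; have [g gE] := dual_comp (b i) eI.
have [r gr] := bgen g; exists (r i) => a.
pose y : submod I := exist (fun x : R^o => x \in I) _ (eI a).
have := coordinate_eq (x := y) (y := a) (c := fun j => (j == i)%:R) (d := r) SW.
by rewrite eqxx mul1r delta_combination -gr (gE a y) //; apply.
Qed.

End Dual.

(** * Endomorphisms of a weakly full ideal *)

Section WeaklyFull.
Context (R : idomainType) (m I : ideal R).
Context (Rnoeth : noetherian R) (Rlocal : local_ring m) (Rdim : krull_dim R 1).
Context (Inonzero : nonzero_ideal I) (Iproper : is_proper I) (Ifull : weakly_full m I).

Local Notation N := (dual_mod (submod I)).

Lemma weakly_fullP (x : R) : (forall w, w \in m -> w * x \in idealM m I) -> x \in I.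
Proof.
by move=> mx; apply: Ifull; apply/asboolP => w wm; rewrite mulrC; apply: mx.
Qed.

(** Take [t] outside [I] with [m t] inside [I]. If [I] were inside [m I], then so would be [m t],
    and weak fullness would put [t] in [I]. *)
Lemma weakly_full_not_sub : ~ {subset I <= idealM m I}.
Proof.
have [a Ia a0] := Inonzero.
have I1 : (1 : R) \notin I.
  have [x Ix] := Iproper; apply: contra Ix => I1.
  by rewrite -[x]mulr1; apply: ideal_mulr.
have [|t tI mt] := @socle_element R m Rnoeth Rlocal Rdim R^o I 1 a I1 a0.
  by rewrite [_ *: _]mulr1.
move=> ImI; case/negP: tI; apply: weakly_fullP => w wm; apply: ImI.
exact: mt.
Qed.

(** The cases are the number of minimal generators of the dual: zero is impossible because the
    inclusion [one] is nonzero, one forces [e] to be a scalar, and two or more are contradictory. *)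
Lemma weakly_full_endomorphism (e : N) :
    torsion_free (tensor_mod (submod I) N) -> (forall a, app e a \in I) ->
  exists r, forall a, app e a = r * \val a.
Proof.
move=> Itf eI; apply: contrapT => e_nonscalar.
have [a Ia va0] := Inonzero.
pose a0 : submod I := exist (fun x : R^o => x \in I) _ Ia.
have a00 : a0 != 0 by apply: contra va0 => /eqP a00; rewrite -[a]/(\val a0) a00.
have [one oneE] : exists one : N, app one =1 \val by apply: dual_of => r x y.
have [n [b [bgen bmin]]] := dual_minimal_generators Rnoeth Rlocal a00.
case: n b bgen bmin => [|[|n]] b bgen bmin.
- have [r oneb] := bgen one; move: va0; rewrite -[a]/(\val a0) -oneE oneb.
  by rewrite app_combination big_ord0 eqxx.
(* With a single generator, [b ord0 o e] is [r ord0] times [b ord0]; exchanging arguments and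
   cancelling [b ord0] at [a0] gives [e]. *)
- apply: e_nonscalar; have [h hE] := dual_comp (b ord0) eI.
  have [r hb] := bgen h; exists (r ord0) => x.
  pose y : submod I := exist (fun x : R^o => x \in I) _ (eI x).
  have b0 : app (b ord0) a0 != 0.
    apply/eqP => /(app_eq0 a00) b0; move: (one_notin_maximal Rlocal).
    suff -> : (1 : R) \in m by [].
    apply: (bmin (fun=> 1) _ ord0).
    by rewrite big_ord_recl big_ord0 b0 scaler0 addr0.
  apply: (mulIf b0); rewrite -[app e x]/(\val y) mulrC app_exchange -(hE x y) //.
  rewrite hb app_combination big_ord_recl big_ord0 addr0 -!mulrA; congr (_ * _).
  by rewrite app_exchange mulrC.
have relP i : exists W : ideal R, forall w, w \in W <->
    exists2 r : 'I_n.+2 -> R, \sum_j r j *: b j = 0 & r i = w.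
  apply: submodule_of.
    by exists (fun=> 0) => //; rewrite big1 // => j _; rewrite scale0r.
  move=> c _ _ [r r0 <-] [s s0 <-]; exists (fun j => c * r j + s j) => //.
  under eq_bigr do rewrite scalerDl -scalerA.
  by rewrite big_split /= -scaler_sumr r0 s0 scaler0 addr0.
have [W WP] := choice relP.
have Wm i : {subset W i <= m} by move=> w /WP [r r0 <-]; apply: bmin.
have [S SE] := choice (fun i => idealM_ideal (W i) I).
have SW i (r : 'I_n.+2 -> R) : \sum_j r j *: b j = 0 ->
    forall x : submod I, r i * \val x \in S i.
  move=> r0 x; rewrite SE; apply: idealM_mem; last exact: (svalP x).
  by apply/WP; exists r.
have [T TE] := idealM_ideal m I.
have ST i : {subset S i <= T}.
  move=> x; rewrite SE; apply: submod_span_min => _ [w [y [/Wm wm Iy ->]]].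
  by rewrite TE; apply: idealM_mem.
have [j bj] : exists j, ~ forall x, app (b j) x \in I.
  apply: contrapT => /forallNP bI'.
  have bI j x : app (b j) x \in I by have /contrapT := bI' j.
  apply: weakly_full_not_sub => x Ix; rewrite -TE.
  pose x' : submod I := exist (fun x : R^o => x \in I) _ Ix.
  rewrite -[x]/(\val x') -oneE; have [r ->] := bgen one; rewrite app_combination.
  apply: rpred_sum => j _; apply: ideal_mulr.
  have [i ij] : exists i : 'I_n.+2, j != i.
    have [->|] := eqVneq j ord0; first by exists (lift ord0 ord0).
    by exists ord0.
  (* [b j x (x) b i] and [b i x (x) b j] have equal evaluations, and their [i]-th coordinates are
     [b j x] and [0]. Hence [b j x] lies in [W i I], inside [m I]. *)
  apply: (ST i); pose y k : submod I := exist (fun x : R^o => x \in I) _ (bI k x').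
  have := coordinate_eq (x := y j) (y := y i) (c := fun k => (k == i)%:R)
    (d := fun k => (k == j)%:R) Itf a00 bgen (SW i).
  rewrite eqxx mul1r (eq_sym i) (negPf ij) mul0r subr0 !delta_combination; apply.
  (* Equality of the evaluations is proved after multiplying by [x], so [x = 0] is treated apart. *)
  have [x0|x0] := eqVneq (\val x' : R) 0.
    have y0 k : y k = 0.
      apply: val_inj; have x'0 : x' = 0 by apply: val_inj.
      by rewrite /= x'0 app0.
    by rewrite !y0 !app0.
  by apply: (mulIf x0); rewrite app_exchange [RHS]app_exchange mulrC.
have [E EP] : exists E : submodClosed N, forall f, f \in E <-> forall x, app f x \in I.
  apply: submodule_of; first by move=> x; rewrite app_zerol; apply: rpred0.
  move=> r f g fI gI x; rewrite app_addl app_scalel; apply: rpredD => //.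
  exact: ideal_mulr.
have bjE : b j \notin E by apply/negP => /EP.
(* The multiplier [a] is admissible: [a] times any functional takes values in [I]. *)
have [|r0 fE mf] := @socle_element R m Rnoeth Rlocal Rdim N E (b j) a bjE va0.
  by apply/EP => x; rewrite app_scalel mulrC; apply: ideal_mulr.
move: (r0 *: b j) fE mf => f fE mf.
have [x1 fx1] : exists x, app f x \notin I.
  apply: contrapT => /forallNP fI; case/negP: fE; apply/EP => x.
  by apply: contrapT => /negP; apply: fI.
have [|t tx1 mtx1] := @socle_element R m Rnoeth Rlocal Rdim R^o I (app f x1) a fx1 va0.
  by rewrite [_ *: _]mulrC; apply: ideal_mulr.
have [z zm zx] : exists2 z, z \in m & z * (t * app f x1) \notin idealM m I.
  apply: contrapT => nz; case/negP: tx1; apply: weakly_fullP => w wm.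
  by apply: contrapT => /negP wx; apply: nz; exists w.
have zfI x : app (z *: f) x \in I by move: x; apply/EP; apply: mf.
have [r rE] := stable_functional_scalar Itf a00 bgen (SW ord0) zfI.
(* If [r] were in [m], then [z * f (t x1)], congruent to [r * t x1] modulo [W ord0 I], would lie in
   [m I]. *)
have [s sr] : exists s, s * r = 1.
  apply: (notin_maximal_unit Rnoeth Rlocal); apply: contra zx => rm.
  rewrite -appZ -app_scalel -TE -[app _ _](subrK (r * \val (t *: x1))).
  apply: rpredD; first exact/ST/rE.
  by rewrite TE; apply: idealM_mem => //; apply: (svalP (t *: x1)).
(* For a relation [c], each [c k * f x] lies in [I], since [c k] is in [m]. The sum of the
   [c k f x (x) b k] evaluates to zero and has [c ord0 * f x] as coordinate at [ord0]. *)
have fW x w : w \in W ord0 -> app f x * w \in S ord0.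
  move=> /WP [c c0 <-].
  have cf k : c k * app f x \in I.
    by rewrite -app_scalel; move: x; apply/EP; apply: mf; apply: bmin.
  pose y k : submod I := exist (fun x : R^o => x \in I) _ (cf k).
  have := coordinate_kernel Itf a00 bgen (SW ord0) (x := y) (c := fun k i => (i == k)%:R).
  have -> : \sum_k (ord0 == k)%:R * \val (y k) = app f x * c ord0.
    rewrite (bigD1 ord0) //= mul1r big1 ?addr0 => [|k k0]; first exact: mulrC.
    by rewrite eq_sym (negPf k0) mul0r.
  apply; apply: (mulIf va0); rewrite mul0r mulr_suml.
  rewrite (eq_bigr (fun k => app f x * (c k * app (b k) a0))) => [|k _].
    by rewrite -mulr_sumr -app_combination c0 app_zerol mulr0.
  rewrite delta_combination -[a]/(\val a0) app_exchange /= mulrC.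
  by rewrite -[RHS]mulrCA mulrA.
have [U UE] := idealM_ideal m (S ord0).
have SU : {subset S ord0 <= idealM m (S ord0)}.
  move=> x; rewrite SE => xS; rewrite -UE; apply: submod_span_min xS.
  move=> _ [w [y [Ww Iy ->]]].
  pose y' : submod I := exist (fun x : R^o => x \in I) _ Iy.
  (* Here [f y' * w] and [z f y' - r y] both lie in [S ord0], while [z] and [w] lie in [m]. *)
  have -> : w * y = s * (z * (app f y' * w) - w * (app (z *: f) y' - r * y)).
    rewrite app_scalel [w * (_ - _)]mulrBr opprB addrCA [w * (z * _)]mulrC -mulrA.
    by rewrite subrr addr0 [w * (r * y)]mulrCA [RHS]mulrA sr mul1r.
  apply: ideal_mulr; rewrite -mulN1r; apply: rpredD; last apply: ideal_mulr.
    by rewrite UE; apply: idealM_mem => //; apply: fW.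
  by rewrite UE; apply: idealM_mem (Wm _ _ Ww) (rE y').
pose i1 : 'I_n.+2 := lift ord0 ord0.
have w0 : app (b i1) a0 != 0.
  apply/eqP => /(app_eq0 a00) b0; move: (one_notin_maximal Rlocal).
  suff : (i1 == i1)%:R \in m by rewrite eqxx => ->.
  by apply: (bmin (fun k => (k == i1)%:R)); rewrite delta_combination.
have : app (b i1) a0 * a = 0.
  apply: (nakayama Rnoeth Rlocal SU); rewrite SE; apply: idealM_mem => //.
  (* The Koszul relation between [b ord0] and [b i1], with the values at [a0] as coefficients; it
     puts the nonzero [b i1 a0] in [W ord0]. *)
  apply/WP; exists (fun k => app (b i1) a0 * (k == ord0)%:R - app (b ord0) a0 * (k == i1)%:R).
    under eq_bigr do rewrite scalerBl -!scalerA.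
    rewrite sumrB -!scaler_sumr !delta_combination; apply: (app_eq0 a00).
    by rewrite app_addl -scaleN1r !app_scalel mulN1r mulrC subrr.
  by rewrite /= mulr1 mulr0 subr0.
by move/eqP; rewrite mulf_eq0 (negPf w0) (negPf va0).
Qed.

End WeaklyFull.

(** Take [r] outside [R a] with [m r] inside [R a]. Either some [w r] with [w] in [m] is a unit
    times [a], and [w] generates [m]; or [r / a] maps [m] into [m], hence [I] into [I] by weak
    fullness, and [weakly_full_endomorphism] contradicts the choice of [r]. *)
Theorem proposition1p3 (R : idomainType) (m I : ideal R)
  (Rnoetherian : noetherian R) (Rlocal : local_ring m) (Rdim : krull_dim R 1)
  (Inonzero : nonzero_ideal I) (Iproper : is_proper I)
  (Ifull : weakly_full m I)
  (Itf : torsion_free (tensor_mod (submod I) (dual_mod (submod I)))) :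
  principal_ideal I /\ dvr R.
Proof.
suff Rdvr : dvr R by split=> //; apply: Rdvr.1.
have [a Ia a0] := Inonzero.
have am : a \in m := proper_sub_maximal Rnoetherian Rlocal Iproper Ia.
have [X XP] := principal_of a.
have X1 : (1 : R) \notin X.
  apply/negP => /XP [s s1]; move: (one_notin_maximal Rlocal).
  by rewrite s1 ideal_mulr.
have [|r rX mr] := @socle_element R m Rnoetherian Rlocal Rdim R^o X 1 a X1 a0.
  by apply/XP; exists 1; rewrite mulrC.
have {}rX : r \notin X by rewrite -[r]mulr1.
have {}mr w : w \in m -> exists u, w * r = u * a.
  by move=> /mr /XP; rewrite [r *: _]mulr1.
have [[w [u [wm um wr]]]|no_unit] :=
    pselect (exists w u, [/\ w \in m, u \notin m & w * r = u * a]).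
  have [s su] := notin_maximal_unit Rnoetherian Rlocal um.
  have aE : a = s * w * r by rewrite -mulrA wr mulrA su mul1r.
  have r0 : r != 0 by apply: contra rX => /eqP ->; apply: rpred0.
  apply: (principal_maximal_dvr Rnoetherian Rlocal _ wm); first by exists a.
  (* From [x r = v a] and [a = s w r], cancelling [r] gives [x = v s w]. *)
  move=> x /mr [v xr]; exists (v * s); apply: (mulIf r0).
  by rewrite xr aE !mulrA.
have /choice [u uE] (x : submod I) : exists u, \val x * r = u * a.
  by apply: mr; apply: proper_sub_maximal (svalP x).
(* [e] is multiplication by [r / a] on [I], with values in [R] because [I] lies in [m]. *)
have [e eE] : exists e : dual_mod (submod I), app e =1 u.
  apply: dual_of => c x y; apply: (mulIf a0); rewrite -uE [RHS]mulrDl -uE.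
  rewrite -[X in _ = X * a + _]/(c * u x) -[c * u x * a]mulrA -uE.
  by rewrite linearD linearZ /= mulrDl -[in LHS]mulrA.
have eI x : app e x \in I.
  apply: (weakly_fullP Ifull) => w wm; have [v wr] := mr w wm.
  have vm : v \in m.
    by apply: contrapT => /negP vm; apply: no_unit; exists w, v.
  have -> : w * app e x = v * \val x.
    by apply: (mulIf a0); rewrite -mulrA eE -uE mulrCA wr mulrCA mulrA.
  by apply: idealM_mem => //; apply: (svalP x).
have [s sE] := weakly_full_endomorphism Rnoetherian Rlocal Rdim Inonzero Iproper Ifull Itf eI.
(* Comparing the two formulas for [e] at [a] gives [r = s a]. *)
case/negP: rX; apply/XP; exists s; apply: (mulIf a0).
pose a' : submod I := exist (fun x : R^o => x \in I) _ Ia.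
by rewrite mulrC -[a]/(\val a') uE -eE sE.
Qed.
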